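(* Let $(X,\mathcal U)$ be a $\beta$-defavorable uniform space and let $f\in U(X)$. Suppose that for every $h\in U^*(X)$, the product function $fh$ is proximally continuous. Then there is $n\in\mathbb N$ such that the set $\{x\in X:|f(x)|\ge n\}$ is uniformly isolated in $(X,\mathcal U)$.
   Context: Uniform spaces are Hausdorff, given by their filters $\mathcal U$ of entourages; all $U\in\mathcal U$ considered are assumed open and symmetric. $\mathbb N$ denotes the positive integers. $U(X)$ is the set of real-valued uniformly continuous functions on $X$ and $U^*(X)$ the set of bounded ones. For $U\in\mathcal U$ and $F\subset X$, $U[F]=\{x\in X:(x,y)\in U\text{ for some }y\in F\}$ and $U[x]=U[\{x\}]$. A set $A\subset X$ is uniformly isolated in $(X,\mathcal U)$ if there is $U\in\mathcal U$ with $U[x]=\{x\}$ for every $x\in A$. A function $f:X\to\mathbb R$ is proximally continuous if for every $A\subset X$ and $\varepsilon>0$ there is $U\in\mathcal U$ with $f(U[A])\subset B(f(A),\varepsilon)$, where $B(f(A),\varepsilon)$ is the $\varepsilon$-enlargement of $f(A)$ in $\mathbb R$. The game $\mathcal J(D)$: let $D$ be a dense subset of $X\times X$ (with $X$ carrying the topology induced by $\mathcal U$). Two players $\alpha$ and $\beta$ play a game of length $\omega$. Player $\alpha$ moves first, choosing $W_0\in\mathcal U$, and Player $\beta$ answers with a point $(x_0,y_0)\in W_0\cap D$. At stage $n$, Player $\alpha$ chooses $W_n\in\mathcal U$ and then Player $\beta$ chooses $(x_n,y_n)\in W_n\cap D$. Player $\alpha$ wins the play $(W_n,(x_n,y_n))_n$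 if for every infinite set $I$ of indices and every $U\in\mathcal U$ there are indices $n,m$ such that $\{n,m\}\cap I\neq\emptyset$ and $(x_n,y_m)\in U$; otherwise Player $\beta$ wins. The uniform space $(X,\mathcal U)$ is $\beta$-defavorable if there is a dense set $D\subset X\times X$ such that Player $\beta$ has no winning strategy in $\mathcal J(D)$. *)

(* Defs.v *)
From HB Require Import structures.
From mathcomp Require Import all_boot all_order all_algebra.
From mathcomp Require Import all_classical all_reals all_analysis.
Import Order.TTheory GRing.Theory Num.Theory.
Import numFieldNormedType.Exports.

Set Implicit Arguments.
Unset Strict Implicit.
Unset Printing Implicit Defensive.

Local Open Scope classical_set_scope.
Local Open Scope ring_scope.

Definition os_entourage (X : uniformType) (U : set (X * X)) : Prop :=
  [/\ entourage U, open U & (U^-1)%relation = U].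

(* U[F], with the convention that the point of F is the second coordinate. *)
Definition ent_nbhd (X : Type) (U : set (X * X)) (F : set X) : set X :=
  [set x | exists2 y, F y & U (x, y)].

Definition uniformly_isolated (X : uniformType) (A : set X) : Prop :=
  exists2 U : set (X * X), os_entourage U &
    forall x, A x -> ent_nbhd U [set x] = [set x].

Definition enlargement (R : realType) (B : set R) (e : R) : set R :=
  \bigcup_(b in B) ball b e.

Definition proximally_continuous (R : realType) (X : uniformType)
    (f : X -> R) : Prop :=
  forall (A : set X) (e : R), 0 < e ->
    exists2 U : set (X * X), os_entourage U &
      f @` ent_nbhd U A `<=` enlargement (f @` A) e.

Section Game.
Variable X : uniformType.

Definition alpha_wins (p : nat -> X * X) : Prop :=
  forall (I : set nat) (U : set (X * X)), infinite_set I -> os_entourage U ->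
    exists n m : nat, (I n \/ I m) /\ U ((p n).1, (p m).2).

(* The argument is the list [:: W_0; ...; W_n] of the moves made so far by
   Player alpha. The earlier answers of Player beta need not be recorded, since
   they are determined by the strategy and the prefixes of this list. *)
Definition beta_strategy := seq (set (X * X)) -> X * X.

Definition alpha_moves (W : nat -> set (X * X)) : Prop :=
  forall n, os_entourage (W n).

Definition beta_answers (s : beta_strategy) (W : nat -> set (X * X))
    (n : nat) : X * X := s (mkseq W n.+1).

(* Every legal finite sequence of moves of Player alpha extends to an infinite
   one, so the first clause says that s obeys the rules at every position. *)
Definition beta_winning (D : set (X * X)) (s : beta_strategy) : Prop :=
  forall W, alpha_moves W ->
    (forall n, (W n `&` D) (beta_answers s W n)) /\
    ~ alpha_wins (beta_answers s W).

Definition beta_defavorable : Prop :=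
  exists2 D : set (X * X), dense D &
    ~ (exists s : beta_strategy, beta_winning D s).

End Game.

(* Main.v *)
(** Suppose that no set [{n <= |f|}] is uniformly isolated.  Then every entourage
    contains pairs of distinct points at which [|f|] is as large as desired, and
    Player beta can choose [(x_n, y_n)] in [W_n] and [D] with [x_n <> y_n],
    [|f(x_n) - f(y_n)| < 1/4] and [|f(x_(n+1))| > |f(x_n)| + 3].  Since [f] is
    uniformly continuous and separates the indices, a play won by Player alpha
    has a pair [(x_k, y_k)] in every entourage.  Choose bumps [u_n] around [y_n],
    supported where [|f|] is close to [|f(y_n)|], with [u_n(x_n) = 0] and
    [u_n(y_n) = 1/|f(y_n)|].  Their supports are disjoint and their heights tend
    to [0], so their sum [h] is uniformly continuous and bounded.  But [f h]
    vanishes on all [x_n] and has modulus [1] at all [y_n], which contradicts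
    proximal continuity. *)
Require Import Defs.
From HB Require Import structures.
From mathcomp Require Import all_boot all_order all_algebra.
From mathcomp Require Import all_classical all_reals all_analysis.
From mathcomp Require Import lra.
Import Order.TTheory GRing.Theory Num.Theory.
Import numFieldNormedType.Exports.
Local Open Scope classical_set_scope.
Local Open Scope ring_scope.

(** * Entourages and separation of points in a uniform space *)

Lemma unif_continuous_realP (R : realType) (X : uniformType) (f : X -> R) :
  unif_continuous f <->
  forall e : R, 0 < e -> entourage [set p : X * X | `|f p.1 - f p.2| < e].
Proof.
split=> [ucf e e0|ucf E].
  apply: (ucf [set p : R * R | ball p.1 e p.2]).
  exact: (entourage_ball _ (PosNum e0)).
rewrite -entourage_ballE => -[e /= e0 sE].
by apply: filterS (ucf e e0) => -[x y] /= xy; exact: sE.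
Qed.

Lemma entourage_split_sym (X : uniformType) (E : set (X * X)) : entourage E ->
  exists2 B, entourage B &
    (forall x y, B (x, y) -> B (y, x)) /\
    (forall x y z, B (x, y) -> B (y, z) -> E (x, z)).
Proof.
move=> entE; exists (split_ent E `&` (split_ent E)^-1%relation).
  apply: filterI; first exact: entourage_split_ent.
  exact: entourage_inv (entourage_split_ent entE).
split=> [x y [Exy Eyx]|x y z [Exy _] [Eyz _]] //.
exact: (entourage_split y entE).
Qed.

(** The interior of [E] is still an entourage: if [C] is symmetric and its fourfold composite lies
    in [E], then [C[x] * C[y]] is a neighbourhood inside [E] of each [(x, y)] in [C]. Intersecting
    with the inverse restores symmetry. *)
Lemma os_entourage_sub (X : uniformType) (E : set (X * X)) :
  entourage E -> exists2 V, os_entourage V & V `<=` E.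
Proof.
move=> entE; have [B entB [symB BE]] := entourage_split_sym X E entE.
have [C entC [symC CB]] := entourage_split_sym X B entB.
have CsubE : C `<=` E°.
  move=> [x y] Cxy; exists (xsection C x, xsection C y) => /=.
    by split; exact: nbhs_entourage.
  move=> [u v] /= [/xsectionP Cxu /xsectionP Cyv].
  apply: (BE _ x); first exact: CB (symC _ _ Cxu) (entourage_refl _ entC).
  exact: CB Cxy Cyv.
have entI : entourage E° by exact: filterS entC.
have oI : open E° by exact: open_interior.
exists (E° `&` (E°)^-1%relation); last by move=> p [/interior_subset].
split.
- by apply: filterI => //; exact: entourage_inv.
- apply: openI => //; apply: (open_comp _ oI) => -[x y] _.
  by apply: cvg_pair => /=; [exact: cvg_snd|exact: cvg_fst].
- by apply/seteqP; split=> -[x y] [].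
Qed.

(** An entourage [E] omitting [(a, b)] generates a coarser pseudometrizable uniformity, its gauge;
    [d] is the distance to [b] there, divided by its value at [a]. *)
Lemma unif_separation (R : realType) (X : uniformType) (a b : X) :
  hausdorff_space X -> a != b ->
  exists d : X -> R,
    [/\ unif_continuous d, d b = 0, d a = 1 & forall x, 0 <= d x].
Proof.
rewrite open_hausdorff => hX /hX[[A B] /= [/set_mem Aa /set_mem Bb]].
move=> [oA oB /eqP AB0].
have : nbhs a A by exact: open_nbhs_nbhs.
rewrite -nbhs_entourageE => -[E entE EA].
pose T : pseudoMetricType R := gauge.type entE.
have [eps eps0 epsE] : exists2 eps : R, 0 < eps &
    forall x y : T, ball x eps y -> E (x, y).
  have : @entourage T E by exists 0%N => // p [].
  rewrite -entourage_ballE => -[e e0 eE]; exists e => // x y xy.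
  exact: (eE (x, y)).
have dfin x y : @edist R T (x, y) \is a fin_num.
  apply/edist_finP => /=; exists 2 => //.
  exact: countable_uniform.countable_uniform_bounded.
pose dist (x y : T) : R := fine (edist (x, y)).
have dist_tri x y z : dist x z <= dist x y + dist y z.
  by rewrite -lee_fin EFinD !fineK //; exact: edist_triangle.
have distC x y : dist x y = dist y x by rewrite /dist edist_sym.
have dist_ball x y r : 0 < r -> ball x r y -> dist x y <= r.
  by move=> r0 xy; rewrite -lee_fin fineK //; exact: edist_fin.
have da0 : 0 < dist b a.
  rewrite lt_neqAle fine_ge0 ?andbT //; apply/eqP => ba0.
  have /epsE Eab : ball (a : T) eps b.
    apply: (@edist_lt_ball R T eps (a, b)).
    by rewrite -(fineK (dfin a b)) lte_fin -/(dist a b) distC -ba0.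
  have : (A `&` B) b by split => //; apply: EA; exact/xsectionP.
  by rewrite AB0.
exists (fun x => dist b x / dist b a); split.
- apply/unif_continuous_realP => e e0.
  apply: (gauge.gauge_ent entE).
  have e20 : 0 < e * dist b a / 2 by rewrite divr_gt0 // mulr_gt0.
  apply: (@filterS _ (@entourage T) _ [set p | ball p.1 (e * dist b a / 2) p.2]);
    last exact: (entourage_ball _ (PosNum e20)).
  move=> [x y] /= /(dist_ball _ _ _ e20) xy.
  rewrite -mulrBl normrM normfV (gtr0_norm da0) ltr_pdivrMr //.
  apply: (@le_lt_trans _ _ (dist x y)); last by lra.
  have := dist_tri b x y; have := dist_tri b y x; rewrite (distC y x).
  by rewrite ler_norml => ? ?; apply/andP; split; lra.
- by rewrite /dist edist_refl mul0r.
- by rewrite divff // gt_eqF.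
- by move=> x; rewrite divr_ge0 // fine_ge0.
Qed.

(** * Sums of disjoint bumps *)

Lemma disjoint_support_sum (R : realType) (X : uniformType) (u : nat -> X -> R) :
  (forall n, unif_continuous (u n)) ->
  (forall n x, `|u n x| <= n.+1%:R^-1) ->
  (forall m n x, u m x != 0 -> u n x != 0 -> m = n) ->
  exists h : X -> R, [/\ unif_continuous h, bounded_fun h,
    (forall n x, u n x != 0 -> h x = u n x) &
    (forall x, (forall n, u n x = 0) -> h x = 0)].
Proof.
move=> ucu ule udisj.
(* The only index whose term can be nonzero at [x]. The default [0] is harmless: it is used only
   where all terms vanish. *)
pose N x := xget 0%N [set n | u n x != 0].
have NP n x : u n x != 0 -> N x = n.
  move=> unx; apply: (udisj _ _ x) => //.
  by rewrite /N; case: xgetP => [k -> //|/(_ n)].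
exists (fun x => u (N x) x); split=> [|||x]; last by apply.
- apply/unif_continuous_realP => e e0.
  have e20 : 0 < e / 2 by rewrite divr_gt0.
  have [M Me] : exists M, forall n, (M <= n)%N -> n.+1%:R^-1 < e / 4.
    have e40 : 0 < e / 4 by rewrite divr_gt0.
    have [M _ Me] := near_infty_natSinv_lt (PosNum e40).
    by exists M => n /Me.
  (* Finitely many terms need control; from index [M] on, both values are below [e / 4]. *)
  pose E := [set p : X * X | forall i : 'I_M, `|u i p.1 - u i p.2| < e / 2].
  have entE : entourage E.
    apply: filter_forall => i.
    exact: (unif_continuous_realP _ _ _).1.
  apply: filterS entE => -[x y] Exy /=.
  have E' n : `|u n x - u n y| < e / 2.
    have [nM|Mn] := ltnP n M; first exact: (Exy (Ordinal nM)).
    have := ule n x; have := ule n y; have := Me n Mn.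
    move: (n.+1%:R^-1) => r.
    rewrite !ler_norml ltr_norml => ? /andP[? ?] /andP[? ?].
    by apply/andP; split; lra.
  have [NE|NE] := eqVneq (N x) (N y); first by rewrite NE; have := E' (N y); lra.
  (* When the active indices differ, each active term vanishes at the other point, so both values of
     the sum are below [e / 2]. *)
  have u0 z n : n != N z -> u n z = 0.
    by move=> nz; apply/eqP; apply: contraNT nz => /NP ->.
  have := E' (N x); have := E' (N y).
  rewrite (u0 y _ NE) u0 1?eq_sym // sub0r subr0 normrN => ? ?.
  by apply: (le_lt_trans (ler_normB _ _)); lra.
- exists 1; split => // r r1 x _ /=.
  rewrite (le_trans (ule _ _)) // (le_trans _ (ltW r1)) // invf_le1 ?ltr0n //.
  by rewrite ler1n.
- by move=> n x unx; rewrite (NP n).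
Qed.

(** In the truncation of [1 - d - |F - F b|] at [0], the separating function [d] forces the zero at
    [a] and the last term confines the support. Division by [F b >= 1] sets the height without
    enlarging increments. *)
Lemma unif_bump (R : realType) (X : uniformType) (F : X -> R) (a b : X) :
  hausdorff_space X -> a != b -> unif_continuous F -> 1 <= F b ->
  exists u : X -> R, [/\ unif_continuous u, u a = 0, u b = (F b)^-1,
    (forall x, `|u x| <= (F b)^-1) & (forall x, u x != 0 -> `|F x - F b| < 1)].
Proof.
move=> hX ab ucF Fb1; have [d [ucd db0 da1 d0]] := unif_separation R X a b hX ab.
have Fb0 : 0 < F b by apply: lt_le_trans Fb1.
pose v x : R := `|F x - F b|.
exists (fun x => Num.max 0 (1 - d x - v x) / F b); split.
- apply/unif_continuous_realP => e e0.
  have e20 : 0 < e / 2 by rewrite divr_gt0.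
  have /unif_continuous_realP/(_ _ e20) entd := ucd.
  have /unif_continuous_realP/(_ _ e20) entF := ucF.
  apply: filterS2 entd entF => -[x y] /= dxy Fxy.
  rewrite -mulrBl normrM normfV (gtr0_norm Fb0) ltr_pdivrMr //.
  apply: (@lt_le_trans _ _ e); last by rewrite ler_pMr.
  have := ler_dist_dist (F x - F b) (F y - F b).
  have -> : F x - F b - (F y - F b) = F x - F y by lra.
  move=> FF0; have {FF0 Fxy} FF := le_lt_trans FF0 Fxy.
  move: (v x) (v y) (FF : `|v x - v y| < _) dxy => r t.
  rewrite !ltr_norml => /andP[? ?] /andP[? ?].
  by case: (leP 0 (1 - d x - r)) => ?; case: (leP 0 (1 - d y - t)) => ?;
    apply/andP; split; lra.
- rewrite da1 max_l ?mul0r //.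
  by have := normr_ge0 (F a - F b); rewrite -/(v a); lra.
- by rewrite /v db0 subrr normr0 !subr0 max_r // mul1r.
- move=> x; rewrite normrM normfV (gtr0_norm Fb0) ler_pdivrMr // mulVf ?gt_eqF //.
  rewrite ger0_norm ?le_max ?lexx // ge_max ler01 /=.
  by have := d0 x; have := normr_ge0 (F x - F b); rewrite -/(v x); lra.
- move=> x; apply: contraNT; rewrite -leNgt => Fx.
  rewrite max_l ?mul0r //.
  by have := d0 x; rewrite /v; lra.
Qed.

Lemma exists_bounded_bump_function (R : realType) (X : uniformType)
    (f : X -> R) (x y : nat -> X) :
  hausdorff_space X -> unif_continuous f -> (forall n, x n != y n) ->
  (forall n, `|f (x n) - f (y n)| < 1 / 4) ->
  3 < `|f (x 0%N)| ->
  (forall m n, (m < n)%N -> `|f (x m)| + 3 < `|f (x n)|) ->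
  exists h : X -> R, [/\ unif_continuous h, bounded_fun h,
    (forall n, f (x n) * h (x n) = 0) & (forall n, `|f (y n) * h (y n)| = 1)].
Proof.
move=> hX ucf xy fxy fx0 Fx_gap.
pose F z : R := `|f z|.
have ucF : unif_continuous F.
  apply/unif_continuous_realP => e e0.
  apply: filterS ((unif_continuous_realP _ _ _).1 ucf e e0) => p /=.
  exact/le_lt_trans/ler_dist_dist.
have Fxy n : `|F (x n) - F (y n)| < 1 / 4.
  exact: le_lt_trans (ler_dist_dist _ _) (fxy n).
have Fx_lower n : n.+2%:R < F (x n).
  elim: n => [|n IH]; first by rewrite /F; lra.
  by have := Fx_gap _ _ (ltnSn n); move: IH; rewrite /F -[n.+3]addn1 natrD; lra.
have Fy_lower n : n.+1%:R <= F (y n).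
  have := Fx_lower n; have := Fxy n; rewrite -[n.+2]addn1 natrD ltr_norml.
  by move=> /andP[? ?]; lra.
have Fy1 n : 1 <= F (y n) by rewrite (le_trans _ (Fy_lower n)) // ler1n.
have /choice[u uP] n := unif_bump R X F (x n) (y n) hX (xy n) ucF (Fy1 n).
(* For distinct indices the values [F (y n)] differ by more than [3 - 2 / 4], hence by more than
   [2]. *)
have apart m n z : `|F z - F (y m)| < 1 -> `|F z - F (y n)| < 1 -> m = n.
  have [mn|nm|//] := ltngtP m n.
    have := Fx_gap _ _ mn; rewrite -!/(F _).
    have := Fxy m; have := Fxy n; rewrite !ltr_norml.
    by move=> /andP[? ?] /andP[? ?] ? /andP[? ?] /andP[? ?]; exfalso; lra.
  have := Fx_gap _ _ nm; rewrite -!/(F _).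
  have := Fxy m; have := Fxy n; rewrite !ltr_norml.
  by move=> /andP[? ?] /andP[? ?] ? /andP[? ?] /andP[? ?]; exfalso; lra.
have [|n z|m n z|h [uch bh hu h0]] := disjoint_support_sum R X u.
- by move=> n; have [] := uP n.
- have [_ _ _ /(_ z) un _] := uP n; apply: le_trans un _.
  by rewrite lef_pV2 ?posrE ?ltr0n // (lt_le_trans ltr01).
- have [_ _ _ _ um] := uP m; have [_ _ _ _ un] := uP n.
  by move=> /um + /un; exact: apart.
exists h; split=> // n.
  (* By [apart], only the bump [u n] could be nonzero at [x n], and it vanishes there by
     construction. *)
  rewrite h0 ?mulr0 // => m; apply/eqP/negPn/negP => um0.
  have [_ _ _ _ /(_ _ um0) Fxm] := uP m.
  have mn : m = n by apply: apart Fxm _; apply: lt_trans (Fxy n) _; lra.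
  by move: um0; rewrite mn; have [_ -> _ _ _] := uP n; rewrite eqxx.
have Fy0 : 0 < F (y n) by apply: lt_le_trans (Fy1 n).
have uy : u n (y n) = (F (y n))^-1 by have [] := uP n.
rewrite (hu n) uy ?invr_eq0 ?gt_eqF // normrM normfV (gtr0_norm Fy0).
by rewrite divff // gt_eqF.
Qed.

(** * The strategy of Player beta and its refutation *)

Lemma exists_dense_pair (R : realType) (X : uniformType) (f : X -> R)
    (D W : set (X * X)) (c : R) :
  hausdorff_space X -> unif_continuous f -> dense D -> os_entourage W ->
  (forall n, (0 < n)%N -> ~ uniformly_isolated [set x : X | n%:R <= `|f x|]) ->
  exists p : X * X, [/\ W p, D p, p.1 != p.2, c < `|f p.1| &
    `|f p.1 - f p.2| < 1 / 4].
Proof.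
move=> hX /unif_continuous_realP ucf dD [entW oW symW] nonisol.
have q0 : 0 < 1 / 4 :> R by lra.
pose E := [set p : X * X | `|f p.1 - f p.2| < 1 / 4].
have entE : entourage E by exact: ucf.
have [V osV VWE] := os_entourage_sub X _ (filterI entW entE).
have [entV oV symV] := osV.
(* This [n] exceeds [c + 1], so moving [x] to a point of [D] may cost [1 / 4] in [|f|] and still
   leave more than [c]. *)
pose n := (Num.truncn (c + 1)).+1.
have [x nx [y Vxy xy]] : exists2 x, n%:R <= `|f x| &
    exists2 y, V (x, y) & x != y.
  apply: contrapT => noxy; apply: (nonisol n isT); exists V => // x nx.
  apply/seteqP; split=> z /=; last first.
    by move=> ->; exists x => //; exact: entourage_refl.
  move=> [_ -> Vzx]; apply/esym/eqP; apply: contrapT => /negP xz.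
  by apply: noxy; exists x => //; exists z => //; rewrite -symV.
move: hX; rewrite open_hausdorff => /(_ _ _ xy)[[A B] /=].
move=> [/set_mem Ax /set_mem By] [oA oB /eqP AB0].
(* All three conditions persist near [(x, y)], so density of [D] applies to the interior of [S]. *)
pose S := [set p : X * X | V p /\ p.1 != p.2 /\ c < `|f p.1|].
have nS : nbhs (x, y) S.
  have nV : nbhs (x, y) V by exact: open_nbhs_nbhs.
  have nAB : nbhs (x, y) ((A `&` xsection E x) `*` B).
    exists (A `&` xsection E x, B) => //=.
    split; last exact: open_nbhs_nbhs.
    by apply: filterI; [exact: open_nbhs_nbhs|exact: nbhs_entourage].
  apply: filterS2 nV nAB => -[a b] Vab [/= [Aa /xsectionP /= fxa] Bb].
  split=> //; split=> /=; first last.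
    have := truncnS_gt (c + 1); have := ler_dist_dist (f x) (f a).
    by move: nx fxa; rewrite -/n /E /= ler_norml => ? ? /andP[? ?] ?; lra.
  by apply/eqP => ab; rewrite -[False]/(set0 a) -AB0; split; rewrite // ab.
have [p [/interior_subset[Vp [p12 cp]] Dp]] : S° `&` D !=set0.
  by apply: dD; [exists (x, y)|exact: open_interior].
by exists p; have [Wp Ep] := VWE _ Vp.
Qed.

Theorem proposition2p1 (R : realType) (X : uniformType)
  (hausX : hausdorff_space X) (defavX : beta_defavorable X)
  (f : X -> R) (ucf : unif_continuous f)
  (prodf : forall h : X -> R, unif_continuous h -> bounded_fun h ->
     proximally_continuous (fun x => f x * h x)) :
  exists n : nat, (0 < n)%N /\ uniformly_isolated [set x : X | n%:R <= `|f x|].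
Proof.
apply: contrapT => noiso; have [D dD] := defavX; apply.
have nonisol n : (0 < n)%N -> ~ uniformly_isolated [set x : X | n%:R <= `|f x|].
  by move=> n0 ison; apply: noiso; exists n.
have pairP W c osW := exists_dense_pair R X f D W c hausX ucf dD osW nonisol.
have osT : os_entourage [set: X * X] by split; [exact: entourageT|exact: openT|].
have [p0 _] := pairP _ 0 osT.
have /choice[next nextP] : forall q : (X * X) * set (X * X), exists p : X * X,
    os_entourage q.2 -> [/\ q.2 p, D p, p.1 != p.2,
      `|f q.1.1| + 3 < `|f p.1| & `|f p.1 - f p.2| < 1 / 4].
  move=> [p W] /=; have [osW|nosW] := pselect (os_entourage W).
    by have [r rP] := pairP W (`|f p.1| + 3) osW; exists r.
  by exists p.
(* Each answer depends only on the preceding answer and the current entourage; the seed [p0] stands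
   in for the answer before the first move. *)
exists (foldl (fun p W => next (p, W)) p0) => W osW.
set p := beta_answers _ _.
have pS n : p n.+1 = next (p n, W n.+1).
  by rewrite /p /beta_answers mkseqS foldl_rcons.
have p0E : p 0%N = next (p0, W 0%N) by [].
have pP n : [/\ W n (p n), D (p n), (p n).1 != (p n).2 &
    `|f (p n).1 - f (p n).2| < 1 / 4].
  case: n => [|n]; rewrite ?p0E ?pS.
    by have [] := nextP (p0, W 0%N) (osW 0%N).
  by have [] := nextP (p n, W n.+1) (osW n.+1).
split=> [n|awins]; first by have [] := pP n.
have {p0E} f0 : 3 < `|f (p 0%N).1|.
  have [_ _ _ + _] := nextP (p0, W 0%N) (osW 0%N); rewrite -p0E {p0E} /=.
  by have := normr_ge0 (f p0.1); lra.
have {pS} fS n : `|f (p n).1| + 3 < `|f (p n.+1).1|.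
  by have [_ _ _ + _] := nextP (p n, W n.+1) (osW n.+1); rewrite -pS.
have f_gap m n : (m < n)%N -> `|f (p m).1| + 3 < `|f (p n).1|.
  elim: n => // n IH; rewrite ltnS leq_eqVlt => /predU1P[->|/IH mn].
    exact: fS.
  by have := fS n; lra.
have fpq n : `|f (p n).1 - f (p n).2| < 1 / 4 by have [] := pP n.
(* The gap [3] between the values [|f (p n).1|] exceeds [1 + 1 / 4]. *)
have close_eq n m : `|f (p n).1 - f (p m).2| < 1 -> n = m.
  move=> /(le_lt_trans (ler_dist_dist _ _)).
  have := le_lt_trans (ler_dist_dist _ _) (fpq m).
  rewrite !ltr_norml => /andP[? ?] /andP[? ?].
  by have [/f_gap|/f_gap|//] := ltngtP n m => ?; exfalso; lra.
have [n|h [uch bh hx hy]] := exists_bounded_bump_function R X f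
  (fun n => (p n).1) (fun n => (p n).2) hausX ucf _ fpq f0 f_gap.
  by have [] := pP n.
have e20 : 0 < 1 / 2 :> R by lra.
(* On the set of all [(p n).1] the product vanishes, so near it, in the sense of [V], the product
   must stay below [1 / 2] in modulus. *)
have [V [entV _ symV] Vfh] :=
  prodf h uch bh (range (fun n => (p n).1)) (1 / 2) e20.
have entE := (unif_continuous_realP _ _ _).1 ucf 1 ltr01.
have [U osU UVE] := os_entourage_sub X _ (filterI entV entE).
have [n [m [_ /UVE[/= Vnm fnm]]]] := awins setT U infinite_nat osU.
have {m fnm Vnm} Vnn : V ((p n).1, (p n).2) by rewrite {2}(close_eq n m fnm).
have [|_ [z [k _ <-] <-]] := Vfh (f (p n).2 * h (p n).2).
  exists (p n).2 => //; exists (p n).1; first by exists n.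
  by rewrite -symV.
by rewrite hx /ball /= sub0r normrN hy => ?; lra.
Qed.
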